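(* Let $\{\mathsf{P}_{X|\theta}:\theta\in\Theta\}$ be a statistical model for data $X\in\mathbb{X}$. Let $C_\alpha:\mathbb{X}\to 2^\Theta$, $\alpha\in[0,1]$, be a family of confidence regions for $\theta$ satisfying $$\inf_{\theta\in\Theta}\mathsf{P}_{X|\theta}\{C_\alpha(X)\ni\theta\}\ge 1-\alpha\quad\text{for all }\alpha\in[0,1],$$ whose corresponding contour function $$\pi_x(\vartheta)=\sup\{\alpha\in[0,1]:C_\alpha(x)\ni\vartheta\},\quad\vartheta\in\Theta,$$ satisfies $\sup_{\vartheta\in\Theta}\pi_x(\vartheta)=1$ for every $x\in\mathbb{X}$. Then the inferential model whose capacity is the plausibility measure $$\overline\Pi_x(A)=\sup_{\vartheta\in A}\pi_x(\vartheta),\quad A\subseteq\Theta,$$ is valid for $\mathcal{A}=2^\Theta$, that is, $$\sup_{\theta\in A}\mathsf{P}_{X|\theta}\{\overline\Pi_X(A)\le\alpha\}\le\alpha\quad\text{for all }\alpha\in[0,1]\text{ and all }A\subseteq\Theta.$$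
   Context: An inferential model on $(\Theta,\mathcal{A})$, $\mathcal{A}\subseteq 2^\Theta$, assigns to each data value $x$ a sub-additive capacity $\overline\Pi_x:\mathcal{A}\to[0,1]$ (i.e. $\overline\Pi_x(\varnothing)=0$, $\overline\Pi_x(\Theta)=1$, monotone with respect to inclusion, and $\overline\Pi_x(A\cup A')\le\overline\Pi_x(A)+\overline\Pi_x(A')$ for disjoint $A,A'\in\mathcal{A}$). It is assumed throughout that $x\mapsto\overline\Pi_x(A)$ is Borel measurable for all $A\in\mathcal{A}$. A supremum over the empty set is taken in $[0,1]$, hence equals $0$. *)

(* Defs.v *)
From mathcomp Require Import all_boot all_order all_algebra.
From mathcomp Require Import all_classical all_reals all_analysis.

Set Implicit Arguments.
Unset Strict Implicit.
Unset Printing Implicit Defensive.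

Import Order.TTheory GRing.Theory Num.Theory.

Local Open Scope classical_set_scope.
Local Open Scope ring_scope.

Record subadditive_capacity (R : realType) (Theta : Type)
    (calA : set (set Theta)) (cap : set Theta -> R) : Prop := {
  capacity_range : forall A, calA A -> 0 <= cap A <= 1 ;
  capacity_set0 : cap set0 = 0 ;
  capacity_setT : cap setT = 1 ;
  capacity_mono : forall A B, calA A -> calA B -> A `<=` B -> cap A <= cap B ;
  capacity_subadd : forall A B, calA A -> calA B -> calA (A `|` B) ->
    A `&` B = set0 -> cap (A `|` B) <= cap A + cap B }.

Record inferential_model (d : measure_display) (X : measurableType d)
    (R : realType) (Theta : Type) (calA : set (set Theta))
    (Pi : X -> set Theta -> R) : Prop := {
  im_capacity : forall x, subadditive_capacity calA (Pi x) ;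
  im_measurable : forall A, calA A -> measurable_fun setT (fun x => Pi x A) }.

(* The data X is the identity on the sample space, with law [P theta].
   For [A = set0] the extended-real supremum is -oo instead of 0, which does not
   affect a comparison with [alpha >= 0]. *)
Definition valid (d : measure_display) (X : measurableType d)
    (R : realType) (Theta : Type) (P : Theta -> probability X R)
    (calA : set (set Theta)) (Pi : X -> set Theta -> R) : Prop :=
  forall (alpha : R) (A : set Theta), 0 <= alpha <= 1 -> calA A ->
    (ereal_sup [set P theta [set x | (Pi x A <= alpha)%R] | theta in A]
      <= alpha%:E)%E.

(* [C] is used only at levels in [0, 1].  The measurability clause makes
   P_theta {C_alpha(X) contains theta} meaningful: the library's measures are
   total functions with arbitrary values off the sigma-algebra. *)
Record confidence_regions (d : measure_display) (X : measurableType d)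
    (R : realType) (Theta : Type) (P : Theta -> probability X R)
    (C : R -> X -> set Theta) : Prop := {
  coverage_measurable : forall (alpha : R) (theta : Theta),
    0 <= alpha <= 1 -> measurable [set x | C alpha x theta] ;
  coverage : forall alpha : R, 0 <= alpha <= 1 ->
    ((1 - alpha)%:E <=
      ereal_inf [set P theta [set x | C alpha x theta] | theta in setT])%E }.

(* The real [sup] returns 0 on the empty set; the sets below lie in [0, 1], so
   this is exactly the supremum taken in [0, 1]. *)
Definition contour (R : realType) (X Theta : Type) (C : R -> X -> set Theta)
    (x : X) (vartheta : Theta) : R :=
  sup [set alpha : R | 0 <= alpha <= 1 /\ C alpha x vartheta].

Definition plausibility (R : realType) (X Theta : Type)
    (pi : X -> Theta -> R) (x : X) (A : set Theta) : R :=
  sup [set pi x vartheta | vartheta in A].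

(* Main.v *)
(** The plausibility of [A] dominates the contour at every [theta] in [A], and
    the contour at [theta] dominates every level [beta] whose region contains
    [theta]. Hence, for [theta] in [A] and [alpha < beta <= 1], the event
    [plausibility <= alpha] forces the region of level [beta] to miss [theta],
    which has probability at most [beta]; let [beta] decrease to [alpha]. *)
Require Import Defs.
From mathcomp Require Import all_boot all_order all_algebra.
From mathcomp Require Import all_classical all_reals all_analysis.

Set Implicit Arguments.
Unset Strict Implicit.
Unset Printing Implicit Defensive.

Import Order.TTheory GRing.Theory Num.Theory.

Local Open Scope classical_set_scope.
Local Open Scope ring_scope.

(* Since [sup set0 = 0], nonemptiness of [S] can be traded for [0 <= m]. *)
Lemma sup_le_nneg (R : realType) (S : set R) (m : R) :
  0 <= m -> ubound S m -> sup S <= m.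
Proof.
move=> m0 Sm; have [->|S0] := eqVneq S set0; first by rewrite sup0.
by apply: ge_sup => //; exact/set0P.
Qed.

Lemma sup_nneg (R : realType) (S : set R) :
  has_ubound S -> (forall s, S s -> 0 <= s) -> 0 <= sup S.
Proof.
move=> Sub S_ge0; have [->|/set0P[s Ss]] := eqVneq S set0.
  by rewrite sup0.
exact: le_trans (S_ge0 _ Ss) (ub_le_sup Sub Ss).
Qed.

Section Contour.
Variables (R : realType) (X Theta : Type) (C : R -> X -> set Theta).

(** Restricting levels to [0, 1] supplies the bound without which the real [sup] need not dominate
    the members of the set. *)
Lemma contour_has_ubound x t :
  has_ubound [set alpha : R | 0 <= alpha <= 1 /\ C alpha x t].
Proof. by exists 1 => a [] /andP[]. Qed.

Lemma contour_ge0 x t : 0 <= contour C x t.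
Proof. by apply: sup_nneg (contour_has_ubound x t) _ => a [] /andP[]. Qed.

Lemma contour_le1 x t : contour C x t <= 1.
Proof. by apply: sup_le_nneg => // a [] /andP[]. Qed.

Lemma le_contour x t alpha :
  0 <= alpha <= 1 -> C alpha x t -> alpha <= contour C x t.
Proof.
by move=> a01 Cat; apply: ub_le_sup => //; exact: contour_has_ubound.
Qed.

End Contour.

Section Plausibility.
Variables (R : realType) (X Theta : Type) (pi : X -> Theta -> R).
Hypothesis pi_ge0 : forall x t, 0 <= pi x t.
Hypothesis pi_le1 : forall x t, pi x t <= 1.
Implicit Types (x : X) (A B : set Theta).

Lemma plausibility_has_ubound x A : has_ubound [set pi x t | t in A].
Proof. by exists 1 => _ [t _ <-]. Qed.

Lemma plausibility_ge0 x A : 0 <= plausibility pi x A.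
Proof. by apply: sup_nneg (plausibility_has_ubound x A) _ => _ [t _ <-]. Qed.

Lemma le_plausibility x A t : A t -> pi x t <= plausibility pi x A.
Proof.
by move=> At; apply: ub_le_sup; [exact: plausibility_has_ubound | exists t].
Qed.

Lemma plausibility_le x A m :
  0 <= m -> (forall t, A t -> pi x t <= m) -> plausibility pi x A <= m.
Proof. by move=> m0 Am; apply: sup_le_nneg => // _ [t At <-]; exact: Am. Qed.

Lemma plausibility_capacity x : plausibility pi x setT = 1 ->
  subadditive_capacity setT (plausibility pi x).
Proof.
move=> piT; split=> //.
- by move=> A _; rewrite plausibility_ge0 plausibility_le.
- by rewrite /plausibility image_set0 sup0.
- move=> A B _ _ AB; apply: plausibility_le; first exact: plausibility_ge0.
  by move=> t /AB; exact: le_plausibility.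
- move=> A B _ _ _ _.
  apply: plausibility_le; first by rewrite addr_ge0 ?plausibility_ge0.
  (* A point of the union lies in [A] or in [B]: its contour is below that set's plausibility, and
     the other summand is nonnegative. *)
  by move=> t [] /(le_plausibility x) /le_trans; apply;
    rewrite ?lerDl ?lerDr plausibility_ge0.
Qed.

End Plausibility.

(** Coverage bounds the infimum over all parameters, hence the probability at each [theta]; then
    pass to the complement. *)
Lemma coverage_miss (d : measure_display) (X : measurableType d)
    (R : realType) (Theta : Type) (P : Theta -> probability X R)
    (C : R -> X -> set Theta) (beta : R) (theta : Theta) :
  confidence_regions P C -> 0 <= beta <= 1 ->
  (P theta (~` [set x | C beta x theta]) <= beta%:E)%E.
Proof.
move=> HC b01; have mC := coverage_measurable HC theta b01.
have : ((1 - beta)%:E <= P theta [set x | C beta x theta])%E.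
  by apply: le_trans (coverage HC b01) _; apply: ereal_inf_lbound; exists theta.
rewrite probability_setC// -(fineK (fin_num_measure (P theta) _ mC)).
by rewrite lee_fin -EFinB lee_fin lerBlDr => ?; rewrite lerBlDr addrC.
Qed.

Theorem theorem3 (d : measure_display) (X : measurableType d) (R : realType)
    (Theta : Type) (P : Theta -> probability X R) (C : R -> X -> set Theta)
    (HC : confidence_regions P C)
    (Hcontour : forall x : X,
      sup [set contour C x vartheta | vartheta in setT] = 1)
    (Hmeas : forall A : set Theta,
      measurable_fun setT (fun x : X => plausibility (contour C) x A)) :
  inferential_model setT (plausibility (contour C)) /\
  valid P setT (plausibility (contour C)).
Proof.
have c0 := @contour_ge0 _ _ _ C; have c1 := @contour_le1 _ _ _ C.
split.
  split=> [x|A _]; last exact: Hmeas.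
  exact: (plausibility_capacity c0 c1 (Hcontour x)).
move=> alpha A /andP[a0 a1] _; apply: ge_ereal_sup => _ [theta Atheta <-].
set E := [set x | _].
(* [E] is the preimage of a closed ray. Its measurability serves both monotonicity of [P theta] and
   finiteness of [P theta E]. *)
have mE : measurable E.
  rewrite -[E]setTI.
  have -> : E = plausibility (contour C) ^~ A @^-1` `]-oo, alpha].
    by apply/seteqP; split=> x; rewrite /E /= in_itv.
  exact: Hmeas.
(* At [alpha = 1] there is no level [beta] in ]alpha, 1] to approach from. *)
have [->|a_neq1] := eqVneq alpha 1; first exact: probability_le1.
have {a_neq1}a1 : alpha < 1 by rewrite lt_neqAle a_neq1.
have Pbeta (beta : R) : alpha < beta -> beta <= 1 -> (P theta E <= beta%:E)%E.
  move=> ab b1; have b01 : 0 <= beta <= 1 by rewrite b1 (le_trans a0 (ltW ab)).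
  apply: le_trans (coverage_miss theta HC b01).
  apply: le_measure; rewrite ?inE//.
    exact/measurableC/(coverage_measurable HC).
  (* If the region contained [theta], the plausibility of [A] would be at least [beta]; strictness
     of [alpha < beta] contradicts [Ex]. *)
  move=> x /= Ex /(le_contour b01) bc.
  have := lt_le_trans ab (le_trans bc (le_plausibility c1 x Atheta)).
  by rewrite ltNge Ex.
rewrite -(fineK (fin_num_measure (P theta) _ mE)) lee_fin.
apply/ler_addgt0Pr => e e0.
rewrite -lee_fin fineK ?fin_num_measure//.
(* Take [beta = alpha + e] when it is an admissible level; otherwise level 1 already gives a bound
   below [alpha + e]. *)
have [ae1|ae1] := leP (alpha + e) 1; first by apply: Pbeta; rewrite ?ltrDl.
by apply: le_trans (Pbeta 1 a1 (lexx _)) _; rewrite lee_fin ltW.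
Qed.
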